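(* For every pure state $|\psi\rangle\in\mathbb{C}^d$ (unit vector, any $d\ge1$), $$C_{l_1}(|\psi\rangle)\ \ge\ \max\left\{C_r(|\psi\rangle),\ 2^{C_r(|\psi\rangle)}-1\right\}.$$
   Context: Fix the standard basis of $\mathbb{C}^d$. A state is a positive semidefinite $d\times d$ complex matrix of trace $1$; a unit vector $|\psi\rangle$ is identified with the state $|\psi\rangle\langle\psi|$. For a state $\rho=(\rho_{ij})$, the $l_1$-norm coherence is $C_{l_1}(\rho)=\sum_{i\ne j}|\rho_{ij}|$, and the relative entropy of coherence is $C_r(\rho)=\min_{\delta}S(\rho\|\delta)$ over diagonal states $\delta$, which equals $S(\rho_{\mathrm{diag}})-S(\rho)$, where $\rho_{\mathrm{diag}}$ is the diagonal matrix with the same diagonal as $\rho$ and $S(\rho)=-\mathrm{Tr}(\rho\log_2\rho)$ is the von Neumann entropy (with $0\log_2 0=0$). Here $S(\rho\|\delta)=\mathrm{Tr}(\rho\log_2\rho)-\mathrm{Tr}(\rho\log_2\delta)$ is the quantum relative entropy ($+\infty$ if the support of $\rho$ is not contained in that of $\delta$). *)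

(* Defs.v *)
From HB Require Import structures.
From mathcomp Require Import all_boot all_order all_algebra.
From mathcomp Require Import all_classical all_reals all_analysis.
From mathcomp Require Import complex.

Set Implicit Arguments.
Unset Strict Implicit.
Unset Printing Implicit Defensive.

Import Order.TTheory GRing.Theory Num.Theory.

Local Open Scope classical_set_scope.
Local Open Scope ring_scope.
Local Open Scope sesquilinear_scope.

(* In [R[i]], [0 <= z] means that z is real and nonnegative, so that the second
   clause of [psd] is the usual <v|A|v> >= 0. *)
Definition psd (R : realType) (d : nat) (A : 'M[R[i]]_d) : Prop :=
  A \is hermsymmx /\ forall v : 'cV[R[i]]_d, 0 <= (v^t* *m A *m v) 0 0.

Definition state (R : realType) (d : nat) (rho : 'M[R[i]]_d) : Prop :=
  psd rho /\ \tr rho = 1.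

Definition unit_vector (R : realType) (d : nat) (psi : 'cV[R[i]]_d) : Prop :=
  (psi^t* *m psi) 0 0 = 1.

(* |psi><psi| *)
Definition pure_state (R : realType) (d : nat) (psi : 'cV[R[i]]_d) :
  'M[R[i]]_d := psi *m psi^t*.

Definition l1_coherence (R : realType) (d : nat) (rho : 'M[R[i]]_d) : R :=
  \sum_i \sum_(j | i != j) Normc.normc (rho i j).

(* Since [ln] vanishes at 0, so does [log2]. *)
Definition log2 (R : realType) (x : R) : R := ln x / ln 2.

(* Functional calculus of [log2] on a Hermitian matrix (so with real
   eigenvalues), which vanishes on the kernel: rho *m mxlog2 rho thus follows
   the convention 0 log2 0 = 0. *)
Definition mxlog2 (R : realType) (d : nat) (A : 'M[R[i]]_d) : 'M[R[i]]_d :=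
  invmx (spectralmx A)
    *m diag_mx (map_mx (fun z : R[i] => (log2 (complex.Re z))%:C%C)
                       (spectral_diag A))
    *m spectralmx A.

(* The support of a Hermitian matrix is its range, i.e. its column space, hence
   the transpositions. *)
Definition support_le (R : realType) (d : nat) (rho delta : 'M[R[i]]_d) : bool :=
  (rho^T <= delta^T)%MS.

(* For states with [support_le rho delta], the kernel of delta, on which
   [mxlog2 delta] has been set to 0, does not contribute to the second trace;
   both traces are real. *)
Definition relative_entropy (R : realType) (d : nat)
    (rho delta : 'M[R[i]]_d) : \bar R :=
  if support_le rho delta then
    (complex.Re (\tr (rho *m mxlog2 rho) - \tr (rho *m mxlog2 delta)))%:E
  else +oo%E.

Definition diagonal_state (R : realType) (d : nat) (delta : 'M[R[i]]_d) : Prop :=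
  state delta /\ is_diag_mx delta.

(* The minimum is attained (at the diagonal part of rho), so it is the
   infimum. *)
Definition relative_entropy_coherence (R : realType) (d : nat)
    (rho : 'M[R[i]]_d) : \bar R :=
  ereal_inf [set relative_entropy rho delta | delta in @diagonal_state R d].

Definition pow2e (R : realType) (x : \bar R) : \bar R :=
  expeR (x * (ln 2)%:E)%E.

(* Main.v *)
(* It suffices to bound the relative entropy to the dephased state, which is the
   Shannon entropy H of p_i = |psi_i|^2, while C_l1 = (sum_i sqrt p_i)^2 - 1.
   The bound 2^H <= (sum_i sqrt p_i)^2 is Jensen's inequality for the logarithm.
   The bound H <= (sum_i sqrt p_i)^2 - 1 follows by merging outcomes one at a
   time from the binary case H(p, 1 - p) <= 2 sqrt(p (1 - p)); for the latter,
   H(p, 1 - p) / sqrt(p (1 - p)) is shown to be largest at p = 1/2. *)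
Require Import Defs.
From HB Require Import structures.
From mathcomp Require Import all_boot all_order all_algebra.
From mathcomp Require Import all_classical all_reals all_analysis.
From mathcomp Require Import complex.
From mathcomp Require Import ring lra.

Import Order.TTheory GRing.Theory Num.Theory numFieldNormedType.Exports.

Local Open Scope ring_scope.
Local Open Scope sesquilinear_scope.

(** * Entropy inequalities for nonnegative reals *)

Lemma ln_le_sub1 (R : realType) (x : R) : 0 < x -> ln x <= x - 1.
Proof. by move=> x0; rewrite -{1}(subrK 1 x) addrC le_ln1Dx//; lra. Qed.

(* h(p) / sqrt(p (1 - p)) at p = 1 / (1 + t^2), with h the binary entropy in
   nats. *)
Definition binary_entropy_ratio {R : realType} (t : R) : R :=
  (t + t^-1) * ln (1 + t ^+ 2) - 2 * t * ln t.

Lemma is_derive_binary_entropy_ratio (R : realType) (r : R) : 0 < r ->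
  is_derive r 1 binary_entropy_ratio
    (- ((1 - r ^+ 2) * ln (1 + r ^+ 2) + r ^+ 2 * ln (r ^+ 2)) / r ^+ 2).
Proof.
move=> r0; have r_neq0 : r != 0 by rewrite gt_eqF.
have r1 : 0 < 1 + r ^+ 2 by rewrite ltr_wpDr// sqr_ge0.
have Dln := is_derive1_ln r0.
have Dln2 : is_derive ((cst 1 + (@id R) ^+ 2) r) 1 (@ln R) ((1 + r ^+ 2)^-1).
  exact: is_derive1_ln.
have Dinv := is_deriveV r_neq0 (is_derive_id r 1).
have -> : binary_entropy_ratio = (id + (fun t : R => t^-1)) *
    (@ln R \o (cst 1 + (@id R) ^+ 2)) - (2 \*: id) * @ln R by [].
apply: is_derive_eq.
rewrite lnXn//= !fctE /GRing.scale/=.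
field.
by rewrite r_neq0 gt_eqF.
Qed.

(** The ratio increases up to [t = 1], the point [p = 1/2]. With [s = t ^+ 2 <= 1], the bounds
    [ln (1 + s) <= s] and [ln s <= s - 1] give [(1 - s) * ln (1 + s) + s * ln s <= 0], so the
    derivative is nonnegative. *)
Lemma binary_entropy_ratio_le (R : realType) (r : R) : 0 < r <= 1 ->
  binary_entropy_ratio r <= 2 * ln 2.
Proof.
move=> /andP[r0 r1].
have <- : binary_entropy_ratio 1 = 2 * ln (2 : R).
  by rewrite /binary_entropy_ratio ln1 invr1 expr1n mulr0 subr0 (_ : 1 + 1 = 2).
have Dg (t : R) (t0 : 0 < t) := @is_derive_binary_entropy_ratio R t t0.
apply: (@ger0_derive1_ndecr _ _ r 1) => //.
- by move=> t /[!in_itv]/= /andP[rt _]; have [] := Dg t (lt_trans r0 rt).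
- move=> t /[!in_itv]/= /andP[/(lt_trans r0) t0 t1].
  rewrite derive1E (@derive_val _ _ _ _ _ _ _ (Dg t t0)).
  rewrite divr_ge0 ?sqr_ge0// oppr_ge0.
  have s0 : 0 < t ^+ 2 by rewrite exprn_gt0.
  have s1 : t ^+ 2 <= 1 by rewrite expr_le1// ltW.
  have ln1s : ln (1 + t ^+ 2) <= t ^+ 2 by apply: le_ln1Dx; lra.
  have lns := ln_le_sub1 _ _ s0.
  by move: (ln _) (ln _) ln1s lns => u v; nra.
- apply: derivable_within_continuous => t /[!in_itv]/= /andP[rt _].
  by have [] := Dg t (lt_le_trans r0 rt).
Qed.

(** This is the binary entropy bound made homogeneous: scaling [x] and [y] by a common factor scales
    both sides by its square, as the extra logarithms cancel. By symmetry the smaller number is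
    [r * y] with [r <= 1], and the claim is the ratio bound at [r] multiplied by
    [x * y = r * y ^+ 2]. *)
Lemma entropy_merge_le (R : realType) (x y : R) : 0 <= x -> 0 <= y ->
  (x ^+ 2 + y ^+ 2) * ln (x ^+ 2 + y ^+ 2)
    - x ^+ 2 * ln (x ^+ 2) - y ^+ 2 * ln (y ^+ 2) <= 2 * ln 2 * x * y.
Proof.
wlog xy : x y / x <= y => [th|] x0 y0.
  have [xy|/ltW yx] := leP x y; first exact: th.
  have := th _ _ yx y0 x0.
  rewrite [y ^+ 2 + x ^+ 2]addrC; lra.
have [->|xn0] := eqVneq x 0.
  by rewrite expr0n/= add0r !mul0r subr0 mulr0 mul0r subrr.
have xp : 0 < x by rewrite lt_def xn0.
have yp : 0 < y by exact: lt_le_trans xy.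
have [r [rp r1 ->]] : exists r, [/\ 0 < r, r <= 1 & x = r * y].
  by exists (x / y); rewrite divr_gt0// ler_pdivrMr// mul1r divfK// gt_eqF.
have h : binary_entropy_ratio r <= 2 * ln 2.
  by rewrite binary_entropy_ratio_le// rp.
have e1 : (r * y) ^+ 2 + y ^+ 2 = (1 + r ^+ 2) * y ^+ 2 by ring.
have r2 : 0 < 1 + r ^+ 2 by rewrite ltr_wpDr// sqr_ge0.
rewrite e1 exprMn !lnM ?posrE ?exprn_gt0//.
have : r * y ^+ 2 * binary_entropy_ratio r <= r * y ^+ 2 * (2 * ln 2).
  by rewrite ler_pM2l// mulr_gt0// exprn_gt0.
rewrite /binary_entropy_ratio; congr (_ <= _); last by ring.
by field; rewrite gt_eqF.
Qed.

Lemma sum_sqr_le (R : realType) (I : Type) (s : seq I) (x : I -> R) :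
  (forall i, 0 <= x i) ->
  \sum_(i <- s) x i ^+ 2 <= (\sum_(i <- s) x i) ^+ 2.
Proof.
move=> x0; elim: s => [|i s ih]; first by rewrite !big_nil expr0n.
rewrite !big_cons sqrrD.
have : 0 <= \sum_(j <- s) x j by exact: sumr_ge0.
by have := x0 i; nra.
Qed.

(** Leaving the squares unnormalized lets the induction pass to the tail. The tail is merged into
    one outcome of amplitude [sqrt Q], with [Q] its sum of squares; splitting off the head [x i]
    costs at most [2 * ln 2 * x i * sqrt Q]. Since [sqrt Q] is at most the sum of the tail, this is
    covered by the new cross terms of the squared sum. *)
Lemma entropy_le_cross (R : realType) (I : Type) (s : seq I) (x : I -> R) :
  (forall i, 0 <= x i) ->
  (\sum_(i <- s) x i ^+ 2) * ln (\sum_(i <- s) x i ^+ 2)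
    - \sum_(i <- s) x i ^+ 2 * ln (x i ^+ 2)
  <= ln 2 * ((\sum_(i <- s) x i) ^+ 2 - \sum_(i <- s) x i ^+ 2).
Proof.
move=> x0; elim: s => [|i s ih].
  by rewrite !big_nil expr0n/= mul0r !subr0 mulr0.
have Q0 : 0 <= \sum_(j <- s) x j ^+ 2 by apply: sumr_ge0 => j _; rewrite sqr_ge0.
have S0 : 0 <= \sum_(j <- s) x j by exact: sumr_ge0.
have QS : Num.sqrt (\sum_(j <- s) x j ^+ 2) <= \sum_(j <- s) x j.
  by rewrite -[leRHS]ger0_norm// -sqrtr_sqr ler_wsqrtr// sum_sqr_le.
have l2 : 0 <= ln (2 : R) by rewrite ln_ge0// ler1n.
have := entropy_merge_le _ (x i) _ (x0 i) (sqrtr_ge0 (\sum_(j <- s) x j ^+ 2)).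
rewrite sqr_sqrtr// => m.
have c0 : 0 <= 2 * ln 2 * x i by rewrite !mulr_ge0.
have {}m := le_trans m (ler_wpM2l c0 QS).
by rewrite !big_cons; lra.
Qed.

Lemma entropy_le_ln_sum (R : realType) (I : Type) (s : seq I) (x : I -> R) :
  (forall i, 0 <= x i) ->
  \sum_(i <- s) x i ^+ 2 = 1 ->
  - \sum_(i <- s) x i ^+ 2 * ln (x i ^+ 2) <= 2 * ln (\sum_(i <- s) x i).
Proof.
move=> x0 x1; set S := \sum_(i <- s) x i.
have S0 : 0 < S.
  have S0 : 0 <= S by exact: sumr_ge0.
  by have := sum_sqr_le _ _ s _ x0; rewrite x1 -/S; nra.
(* Jensen's inequality through the tangent of [ln] at 1: [ln u <= u - 1] is taken at
   [u = (x i * S)^-1] with weight [2 * x i ^+ 2]. The right-hand sides then sum to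
   [2 * (S / S - 1) = 0]. *)
have le i : - (x i ^+ 2 * ln (x i ^+ 2)) - x i ^+ 2 * (2 * ln S)
    <= 2 * (x i / S - x i ^+ 2).
  have [->|xn0] := eqVneq (x i) 0.
    by rewrite expr0n/= !mul0r !subr0 mulr0 oppr0.
  have xp : 0 < x i by rewrite lt_def xn0 x0.
  have := ln_le_sub1 _ (x i * S)^-1.
  rewrite invr_gt0 mulr_gt0// lnV ?posrE ?mulr_gt0// lnM// lnXn// => /(_ isT).
  move/(ler_wpM2l (mulr_ge0 (ler0n _ 2) (sqr_ge0 (x i)))).
  congr (_ <= _); first by ring.
  by field; rewrite !gt_eqF.
have : \sum_(i <- s) (- (x i ^+ 2 * ln (x i ^+ 2)) - x i ^+ 2 * (2 * ln S))
    <= \sum_(i <- s) 2 * (x i / S - x i ^+ 2) by exact: ler_sum.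
rewrite sumrB sumrN -mulr_suml x1 mul1r -mulr_sumr sumrB x1 -mulr_suml.
by rewrite divff ?gt_eqF// subrr mulr0 subr_le0.
Qed.

(** * Logarithms of Hermitian matrices *)

(** The diagonalizing matrix [P] is not known to be a permutation when entries of [D] repeat.
    Comparing entries in [P *m D = diag_mx L *m P] shows that [D j j = L 0 i] wherever [P i j] is
    nonzero, so [P] also intertwines any function of the two diagonals. *)
Lemma mxlog2_diag (R : realType) (d : nat) (D : 'M[R[i]]_d) :
  is_diag_mx D -> D \is hermsymmx ->
  mxlog2 D = diag_mx (\row_i (log2 (complex.Re (D i i)))%:C%C).
Proof.
move=> /is_diag_mxP Ddiag /hermitian_normalmx/orthomx_spectralP.
set P := spectralmx D; set L := spectral_diag D => DE.
have Pu : P \in unitmx by exact: spectral_unit.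
rewrite /mxlog2 -/P -/L -mulmxA; apply: (canLR (mulKmx Pu)).
have /matrixP PD : P *m D = diag_mx L *m P by rewrite {1}DE -mulmxA mulKVmx.
have PDE i j : P i j * D j j = L 0 i * P i j.
  have := PD i j; rewrite mul_diag_mx !mxE (bigD1 j)//= big1 ?addr0// => k kj.
  by rewrite Ddiag ?mulr0.
apply/matrixP => i j; rewrite mul_diag_mx mul_mx_diag !mxE.
have [->|Pij] := eqVneq (P i j) 0; first by rewrite mulr0 mul0r.
have -> : D j j = L 0 i by apply: (mulIf Pij); rewrite -PDE mulrC.
by rewrite mulrC.
Qed.

(** The eigenvalues of a projection are 0 and 1, and [log2] vanishes at both, at 0 by convention.
    Applied to a pure state, this says that its entropy is zero. *)
Lemma mxlog2_idempotent (R : realType) (d : nat) (A : 'M[R[i]]_d) :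
  A \is hermsymmx -> A *m A = A -> mxlog2 A = 0.
Proof.
move=> /hermitian_normalmx/orthomx_spectralP.
set P := spectralmx A; set L := spectral_diag A => AE AA.
have Pu : P \in unitmx by exact: spectral_unit.
have LL : diag_mx L *m diag_mx L = diag_mx L.
  have PAP : P *m A *m invmx P = diag_mx L.
    by rewrite {1}AE !mulmxA mulmxV// mul1mx mulmxK.
  by rewrite -PAP -!mulmxA mulKmx// [A *m (A *m _)]mulmxA AA.
have L01 i : log2 (complex.Re (L 0 i)) = 0 :> R.
  have /matrixP/(_ i i) := LL; rewrite mul_diag_mx !mxE eqxx !mulr1n => /eqP.
  rewrite -subr_eq0 -{3}[L 0 i]mulr1 -mulrBr mulf_eq0 subr_eq0.
  by case/orP => /eqP->; rewrite /log2/= 1?(ln0 (lexx 0), ln1) mul0r.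
suff -> : mxlog2 A = invmx P *m 0 *m P by rewrite mulmx0 mul0mx.
rewrite /mxlog2 -/P -/L; congr (_ *m _ *m _).
by apply/matrixP => i j; rewrite !mxE L01 mul0rn.
Qed.

(** * Pure states and their dephasing *)

Lemma pure_stateE (R : realType) (d : nat) (psi : 'cV[R[i]]_d) i j :
  pure_state psi i j = psi i 0 * (psi j 0)^*.
Proof. by rewrite mxE big_ord1 !mxE. Qed.

Lemma mul_conj_normc (R : realType) (z : R[i]) :
  z * z^* = (Normc.normc z ^+ 2)%:C%C.
Proof. by rewrite -normCK -rmorphXn. Qed.

Lemma unit_vector_normc (R : realType) (d : nat) (psi : 'cV[R[i]]_d) :
  unit_vector psi -> \sum_i Normc.normc (psi i 0) ^+ 2 = 1.
Proof.
rewrite /unit_vector mxE => h; apply: (@complexI R); rewrite rmorph_sum rmorph1 -h.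
by apply: eq_bigr => i _; rewrite !mxE mulrC mul_conj_normc.
Qed.

Lemma l1_coherence_pure_state (R : realType) (d : nat) (psi : 'cV[R[i]]_d) :
  l1_coherence (pure_state psi) =
  (\sum_i Normc.normc (psi i 0)) ^+ 2 - \sum_i Normc.normc (psi i 0) ^+ 2.
Proof.
rewrite expr2 big_distrl -sumrB; apply: eq_bigr => i _ /=.
rewrite mulr_sumr [X in _ = X - _](bigD1 i)//= -expr2 [_ + \sum_(_ <- _ | _) _]addrC addrK.
apply: eq_big => [j|j _]; first by rewrite eq_sym.
rewrite pure_stateE Normc.normcM; congr (_ * _).
by case: (psi j 0) => a b /=; rewrite sqrrN.
Qed.

Lemma pure_state_hermsym (R : realType) (d : nat) (psi : 'cV[R[i]]_d) :
  pure_state psi \is hermsymmx.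
Proof.
apply/is_hermitianmxP; rewrite expr0 scale1r /pure_state.
by rewrite trmx_mul map_mxM trmxCK.
Qed.

Lemma pure_state_idempotent (R : realType) (d : nat) (psi : 'cV[R[i]]_d) :
  unit_vector psi -> pure_state psi *m pure_state psi = pure_state psi.
Proof.
rewrite /unit_vector /pure_state => h.
rewrite -mulmxA [psi^t* *m (_ *m _)]mulmxA.
have -> : psi^t* *m psi = 1%:M.
  by apply/matrixP => a b; rewrite !ord1 h mxE eqxx.
by rewrite mul1mx.
Qed.

Definition dephased {R : realType} {d : nat} (rho : 'M[R[i]]_d) : 'M[R[i]]_d :=
  diag_mx (\row_i rho i i).

Lemma dephased_pure_stateE (R : realType) (d : nat) (psi : 'cV[R[i]]_d) :
  dephased (pure_state psi) = diag_mx (\row_i (Normc.normc (psi i 0) ^+ 2)%:C%C).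
Proof.
by congr diag_mx; apply/rowP => i; rewrite [LHS]mxE [RHS]mxE pure_stateE mul_conj_normc.
Qed.

Lemma dephased_pure_hermsym (R : realType) (d : nat) (psi : 'cV[R[i]]_d) :
  dephased (pure_state psi) \is hermsymmx.
Proof.
apply/is_hermitianmxP; rewrite expr0 scale1r dephased_pure_stateE.
rewrite tr_diag_mx map_diag_mx; congr diag_mx; apply/rowP => i; rewrite !mxE.
by rewrite -[RHS]/(conjc _) conjc_real.
Qed.

Lemma diagonal_state_dephased (R : realType) (d : nat) (psi : 'cV[R[i]]_d) :
  unit_vector psi -> diagonal_state (dephased (pure_state psi)).
Proof.
move=> psi1; split; last exact: diag_mx_is_diag.
split; last first.
  rewrite dephased_pure_stateE mxtrace_diag -(rmorph1 (real_complex R)).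
  rewrite -(unit_vector_normc _ _ _ psi1) rmorph_sum.
  by apply: eq_bigr => i _; rewrite !mxE.
split; first exact: dephased_pure_hermsym.
move=> v; rewrite dephased_pure_stateE mul_mx_diag mxE; apply: sumr_ge0 => i _.
rewrite !mxE mulrAC [_^* * _]mulrC mul_conj_normc -rmorphM/=.
by rewrite ler0c mulr_ge0// sqr_ge0.
Qed.

Lemma support_le_dephased (R : realType) (d : nat) (psi : 'cV[R[i]]_d) :
  support_le (pure_state psi) (dephased (pure_state psi)).
Proof.
rewrite /support_le /pure_state trmx_mul; apply: (submx_trans (submxMl _ _)).
rewrite -/(pure_state psi) tr_diag_mx.
(* The range of the pure state lies in the line of [psi], so it is enough to divide [psi i 0] by the
   diagonal entry [psi i 0 * (psi i 0)^*]. Where [psi i 0 = 0], both sides vanish. *)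
apply/submxP; exists (\row_i ((psi i 0)^*)^-1).
apply/rowP => i; rewrite mul_mx_diag !mxE big_ord1 !mxE mulrCA.
have [->|pn0] := eqVneq (psi i 0) 0; first by rewrite mul0r.
by rewrite mulVf ?mulr1// conjC_eq0.
Qed.

Lemma relative_entropy_dephased (R : realType) (d : nat) (psi : 'cV[R[i]]_d) :
  unit_vector psi ->
  relative_entropy (pure_state psi) (dephased (pure_state psi)) =
  ((- \sum_i Normc.normc (psi i 0) ^+ 2 * ln (Normc.normc (psi i 0) ^+ 2))
     / ln 2)%:E.
Proof.
move=> psi1; rewrite /relative_entropy support_le_dephased; congr EFin.
(* The pure state is a projection, so the first trace is zero and only the trace against the
   logarithm of the dephased state remains. *)
rewrite mxlog2_idempotent ?pure_state_hermsym ?pure_state_idempotent//.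
rewrite mxlog2_diag ?diag_mx_is_diag ?dephased_pure_hermsym//.
rewrite mulmx0 mxtrace0 sub0r mulNr mulr_suml raddfN; congr (- _).
rewrite /mxtrace raddf_sum; apply: eq_bigr => i _ /=.
rewrite mul_mx_diag !mxE eqxx mulr1n big_ord1 !mxE mul_conj_normc.
by rewrite -rmorphM /= /log2 mulrA.
Qed.

Theorem proposition5 (R : realType) (d : nat) (hd : (1 <= d)%N)
    (psi : 'cV[R[i]]_d) (hpsi : unit_vector psi) :
  (maxe (relative_entropy_coherence (pure_state psi))
        (pow2e (relative_entropy_coherence (pure_state psi)) - 1)
     <= (l1_coherence (pure_state psi))%:E)%E.
Proof.
set x := fun i => Normc.normc (psi i 0).
have x0 i : 0 <= x i by rewrite -ler0c; exact: (normr_ge0 (psi i 0)).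
have x1 : \sum_i x i ^+ 2 = 1 by exact: unit_vector_normc.
set H := - \sum_i x i ^+ 2 * ln (x i ^+ 2).
(* Both members of the maximum are nondecreasing in the coherence, so an upper bound from one
   competitor in the infimum suffices. *)
have Cr : (relative_entropy_coherence (pure_state psi) <= (H / ln 2)%:E)%E.
  rewrite -relative_entropy_dephased//; apply: ereal_inf_lbound.
  by exists (dephased (pure_state psi)) => //; exact: diagonal_state_dephased.
have l2 : 0 < ln (2 : R) by rewrite ln_gt0// ltr1n.
have l1E : l1_coherence (pure_state psi) = (\sum_i x i) ^+ 2 - 1.
  by rewrite l1_coherence_pure_state x1.
have S1 : 1 <= (\sum_i x i) ^+ 2 by rewrite -x1 sum_sqr_le.
have S0 : 0 < \sum_i x i.
  by have := sumr_ge0 _ (fun i _ => x0 i) : 0 <= \sum_i x i; nra.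
rewrite ge_max; apply/andP; split.
  apply: (le_trans Cr); rewrite lee_fin ler_pdivrMr// l1E mulrC.
  by have := entropy_le_cross _ _ (index_enum 'I_d) _ x0; rewrite x1 ln1 mulr0 sub0r.
rewrite l1E EFinB; apply: leeB => //.
(* Writing the squared sum as a power of 2 reduces the second bound to a comparison of exponents. *)
have -> : ((\sum_i x i) ^+ 2)%:E = pow2e (2 * ln (\sum_i x i) / ln 2)%:E.
  by rewrite /pow2e /= divfK ?gt_eqF// mulr_natl -lnXn// lnK// posrE exprn_gt0.
rewrite /pow2e lee_expeR; apply: lee_wpmul2r; first by rewrite lee_fin ltW.
apply: (le_trans Cr); rewrite lee_fin ler_pM2r ?invr_gt0//.
exact: entropy_le_ln_sum.
Qed.
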